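(* For all integers $n>1$, $c\ge1$ and $0\le k\le (c-1)n+c\binom{n}{2}$, we have $i_c(n,k)=\sum_{j=0}^{cn-1} i_c(n-1,k-j)$.
   Context: For integers $n\ge1$, $c\ge1$, let $G_{c,n}$ be the set of colored permutations: words $\sigma=\sigma_1^{[c_1]}\cdots\sigma_n^{[c_n]}$ where $|\sigma|=\sigma_1\cdots\sigma_n$ is a permutation of $[n]$ and each color $c_i\in\{0,\dots,c-1\}$. For a permutation $\pi$ of $[n]$, $\mathrm{inv}(\pi)=|\{(i,j):i<j,\ \pi_i>\pi_j\}|$. Let $\mathrm{col}(\sigma)=c_1+\cdots+c_n$ and $\mathrm{inv}_c(\sigma)=\mathrm{inv}(|\sigma|)+\mathrm{col}(\sigma)+c\cdot|\{(i,j):1\le i<j\le n,\ \sigma_i<\sigma_j,\ c_j\ne0\}|$. Define $i_c(n,k)=|\{\sigma\in G_{c,n}:\mathrm{inv}_c(\sigma)=k\}|$ for all integers $k$ (so $i_c(n,k)=0$ for $k<0$). *)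

(* Defs.v *)
From HB Require Import structures.
From mathcomp Require Import all_boot all_order all_algebra all_fingroup.

Set Implicit Arguments.
Unset Strict Implicit.
Unset Printing Implicit Defensive.

(* Letters, positions and colours are indexed from 0: the letter sigma_(i+1)
   is (s.1 i).+1 and its colour is s.2 i, for i : 'I_n. *)
Definition colored_perm (c n : nat) : finType :=
  ({perm 'I_n} * {ffun 'I_n -> 'I_c})%type.

Definition inv (n : nat) (p : {perm 'I_n}) : nat :=
  #|[set ij : 'I_n * 'I_n | (ij.1 < ij.2) && (p ij.1 > p ij.2)]|.

Definition col (c n : nat) (s : colored_perm c n) : nat :=
  \sum_(i < n) s.2 i.

(* In the last term letters are compared without regard to their colours. *)
Definition inv_c (c n : nat) (s : colored_perm c n) : nat :=
  inv s.1 + col s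
  + c * #|[set ij : 'I_n * 'I_n |
            [&& ij.1 < ij.2, s.1 ij.1 < s.1 ij.2
              & nat_of_ord (s.2 ij.2) != 0]]|.

Definition i_c (c n : nat) (k : int) : nat :=
  #|[set s : colored_perm c n | Posz (inv_c s) == k]|.

(* Main.v *)
(* Delete the last letter of a coloured permutation of [n]. If that letter is
   v and its colour is d, inv_c drops by n - v when d = 0, and by
   n - v + d + c(v - 1) = n + (d - 1) + (c - 1)(v - 1) otherwise. The first case
   yields each value 0, ..., n - 1 once and the second, by Euclidean division
   by c - 1, each value n, ..., cn - 1 once. Hence the pairs (v, d) correspond
   bijectively to the drops j < cn. *)
Require Import Defs.
From mathcomp Require Import all_boot all_order all_algebra all_fingroup.
From mathcomp Require Import zify.

Set Implicit Arguments.
Unset Strict Implicit.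
Unset Printing Implicit Defensive.

Lemma sum_ord_lift_max m (F : 'I_m.+1 -> nat) :
  \sum_(i < m.+1) F i = \sum_(i < m) F (lift ord_max i) + F ord_max.
Proof.
rewrite big_ord_recr; congr (_ + _); apply: eq_bigr => i _; congr F.
by apply: val_inj; rewrite /= /bump leqNgt ltn_ord.
Qed.

Lemma card_pairs_sum m (P : 'I_m -> 'I_m -> bool) :
  #|[set ij : 'I_m * 'I_m | P ij.1 ij.2]| = \sum_i \sum_j P i j.
Proof.
rewrite -sum1dep_card big_mkcond pair_big /=.
by apply: eq_bigr => -[i j] _ /=; case: (P i j).
Qed.

(** A pair of increasing positions either avoids the last position or has it as second entry; it
    cannot have it as first. Applied below to inversions and to the pairs weighted by [c]. *)
Lemma card_lt_pairs_lift_max m (P : 'I_m.+1 -> 'I_m.+1 -> bool) :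
  #|[set ij : 'I_m.+1 * 'I_m.+1 | (ij.1 < ij.2) && P ij.1 ij.2]|
  = #|[set ij : 'I_m * 'I_m |
        (ij.1 < ij.2) && P (lift ord_max ij.1) (lift ord_max ij.2)]|
    + #|[set i : 'I_m | P (lift ord_max i) ord_max]|.
Proof.
rewrite (card_pairs_sum (fun i j => (i < j) && P i j)).
rewrite (card_pairs_sum
  (fun i j : 'I_m => (i < j) && P (lift ord_max i) (lift ord_max j))).
rewrite sum_ord_lift_max [X in _ + X]big1 ?addn0; last first.
  by move=> j _; rewrite ltnNge -ltnS ltn_ord.
rewrite -[X in _ = _ + X]sum1dep_card [X in _ = _ + X]big_mkcond -big_split.
apply: eq_bigr => i _; rewrite sum_ord_lift_max; congr (_ + _).
  by apply: eq_bigr => j _; rewrite !lift_max.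
by rewrite lift_max /= ltn_ord; case: P.
Qed.

Lemma card_perm_lt m (v : 'I_m.+1) (p : {perm 'I_m}) :
  #|[set i : 'I_m | p i < v]| = v.
Proof.
rewrite -sum1dep_card -[RHS]card_ord -sum1_card.
rewrite (big_ord_widen m (fun=> 1)) -1?ltnS ?ltn_ord //.
by rewrite [RHS](reindex_inj (@perm_inj _ p)).
Qed.

Lemma lift_lt m (v : 'I_m.+1) (k : 'I_m) : (lift v k < v) = (k < v).
Proof. by rewrite /= /bump; lia. Qed.

Lemma lift_gt m (v : 'I_m.+1) (k : 'I_m) : (v < lift v k) = ~~ (k < v).
Proof. by rewrite /= /bump; lia. Qed.

Section LastLetter.
Variables c m : nat.

(** The inverse of deleting the last letter: earlier letters that are at least the new one move up
    by one, so their relative order is kept. *)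
Definition append_letter (x : ('I_m.+1 * 'I_c) * colored_perm c m) :
    colored_perm c m.+1 :=
  (lift_perm ord_max x.1.1 x.2.1,
   [ffun i => if unlift ord_max i is Some k then x.2.2 k else x.1.2]).

Lemma append_letter_inj : injective append_letter.
Proof.
move=> [[v d] [p f]] [[v' d'] [p' f']] [/permP/= eq_p /ffunP eq_f].
have eq_v : v = v' by have := eq_p ord_max; rewrite !lift_perm_id.
have eq_d : d = d' by have := eq_f ord_max; rewrite !ffunE unlift_none.
subst v' d'; congr (_, (_, _)).
  apply/permP => i; have := eq_p (lift ord_max i).
  by rewrite !lift_perm_lift => /lift_inj.
by apply/ffunP => i; have := eq_f (lift ord_max i); rewrite !ffunE liftK.
Qed.

Lemma append_letter_bij : bijective append_letter.
Proof.
apply: inj_card_bij append_letter_inj _.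
rewrite !card_prod !card_ffun !card_ord.
have cardS k : #|{: {perm 'I_k}}| = k`! by rewrite -card_Sn; apply: eq_card.
by rewrite !cardS factS expnS; lia.
Qed.

(** The drop caused by deleting the letter, with values counted from 0: [m - v] earlier letters are
    larger and [v] are smaller. *)
Definition letter_weight (x : 'I_m.+1 * 'I_c) : nat :=
  m - x.1 + x.2 + c * (if nat_of_ord x.2 != 0 then x.1 : nat else 0).

Lemma inv_c_append_letter x :
  inv_c (append_letter x) = inv_c x.2 + letter_weight x.1.
Proof.
case: x => [[v d] [p f]].
rewrite /inv_c /Defs.inv /Defs.col /letter_weight /append_letter /=.
set q := lift_perm _ _ _; set g := [ffun i => _].
have q_max : q ord_max = v by rewrite lift_perm_id.
have q_lift i : q (lift ord_max i) = lift v (p i) by rewrite lift_perm_lift.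
have g_max : g ord_max = d by rewrite ffunE unlift_none.
have g_lift i : g (lift ord_max i) = f i by rewrite ffunE liftK.
have lift_ltE (i j : 'I_m) : (lift v i < lift v j) = (i < j).
  by rewrite /= /bump; lia.
have inv_rec := card_lt_pairs_lift_max (fun i j => q j < q i).
have asc_rec := card_lt_pairs_lift_max
  (fun i j => (q i < q j) && (nat_of_ord (g j) != 0)).
cbv beta in inv_rec, asc_rec; rewrite inv_rec asc_rec sum_ord_lift_max.
have -> : \sum_(i < m) g (lift ord_max i) = \sum_(i < m) f i.
  by apply: eq_bigr => i _; rewrite g_lift.
rewrite g_max.
have -> : [set ij : 'I_m * 'I_m |
     (ij.1 < ij.2) && (q (lift ord_max ij.2) < q (lift ord_max ij.1))]
  = [set ij : 'I_m * 'I_m | (ij.1 < ij.2) && (p ij.2 < p ij.1)].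
  by apply/setP => ij; rewrite !inE !q_lift lift_ltE.
(* [lift v] skips the value [v], so an earlier letter that is not below [v] is above it. *)
have -> : [set i | q ord_max < q (lift ord_max i)] = ~: [set i | p i < v].
  by apply/setP => i; rewrite !inE q_lift q_max lift_gt.
have -> : [set ij : 'I_m * 'I_m |
    [&& ij.1 < ij.2, q (lift ord_max ij.1) < q (lift ord_max ij.2)
      & nat_of_ord (g (lift ord_max ij.2)) != 0]]
  = [set ij : 'I_m * 'I_m |
      [&& ij.1 < ij.2, p ij.1 < p ij.2 & nat_of_ord (f ij.2) != 0]].
  by apply/setP => ij; rewrite !inE !q_lift lift_ltE g_lift.
have -> : #|[set i | q (lift ord_max i) < q ord_max & nat_of_ord d != 0]|
          = if nat_of_ord d != 0 then v : nat else 0.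
  case: ifP => d0; last by apply: eq_card0 => i; rewrite !inE andbF.
  rewrite -[RHS](card_perm_lt v p); apply: eq_card => i.
  by rewrite !inE andbT q_lift q_max lift_lt.
rewrite [#|~: _|]cardsCs setCK card_ord card_perm_lt mulnDr.
by rewrite (addnACA #|_|) addnACA.
Qed.

(** The largest weight is [c * m + (c - 1)], reached at [v = m], [d = c - 1]. *)
Lemma letter_weight_lt x : letter_weight x < c * m.+1.
Proof.
case: x => v d; rewrite /letter_weight /=.
by have := ltn_ord v; have := ltn_ord d; case: eqP => /=; nia.
Qed.

(** The weight is [m - v <= m] when [d = 0], and [m + (c - 1) * v + d > m] otherwise, so the two
    cases never meet. *)
Lemma letter_weight_inj : injective letter_weight.
Proof.
move=> [v d] [v' d']; rewrite /letter_weight /= => eq_w.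
have ? := ltn_ord v; have ? := ltn_ord d.
have ? := ltn_ord v'; have ? := ltn_ord d'.
suff [eq_v eq_d] : v = v' :> nat /\ d = d' :> nat.
  by congr (_, _); apply: val_inj.
(* A larger [v] adds at least [c - 1], whereas two nonzero colours differ by at most [c - 2]. *)
have step (a b : nat) : a < b -> c.-1 * a + c.-1 <= c.-1 * b.
  by move=> lt_ab; rewrite -mulnSr leq_mul2l lt_ab orbT.
have mul_c a : c * a = a + c.-1 * a.
  by rewrite -mulSn prednK // (leq_trans _ (ltn_ord d)).
move: eq_w; case: (ltngtP v v') => [/step le_vv'|/step le_vv'|->];
  by do 2![case: eqP => /= ?]; rewrite !mul_c ?muln0; nia.
Qed.

(** Surjectivity onto the values below [c * m.+1] comes from counting: there are equally many pairs
    [(v, d)]. *)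
Lemma sum_letter_weight (F : nat -> nat) :
  \sum_x F (letter_weight x) = \sum_(0 <= j < c * m.+1) F j.
Proof.
rewrite big_mkord; pose h x := Ordinal (letter_weight_lt x).
have h_bij : bijective h.
  apply: inj_card_bij => [x y [/letter_weight_inj] //|].
  by rewrite card_prod !card_ord mulnC.
by rewrite [RHS](reindex h) //; apply: onW_bij.
Qed.

Lemma i_c_rec (k : int) :
  i_c c m.+1 k = \sum_(0 <= j < c * m.+1) i_c c m (k - Posz j)%R.
Proof.
rewrite -(sum_letter_weight (fun j => i_c c m (k - Posz j)%R)).
rewrite /i_c -sum1dep_card (reindex append_letter) /=; last first.
  exact: onW_bij append_letter_bij.
under [RHS]eq_bigr do rewrite -sum1dep_card.
rewrite pair_big_dep /=; apply: eq_bigl => x.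
(* The subtraction is in the integers: a weight above [k] gives a negative argument, where [i_c]
   vanishes. *)
by rewrite inv_c_append_letter PoszD [RHS]eq_sym GRing.subr_eq eq_sym.
Qed.

End LastLetter.

Theorem theorem3p2 (n c : nat) (k : int) (hn : (1 < n)%N) (hc : (1 <= c)%N)
    (hk0 : (0 <= k)%R) (hk : (k <= Posz ((c - 1) * n + c * 'C(n, 2))%N)%R) :
  i_c c n k = (\sum_(0 <= j < c * n) i_c c (n - 1) (k - Posz j)%R)%N.
Proof.
case: n hn {hk} => // m _.
by rewrite subn1 i_c_rec.
Qed.
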